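(* Let $g(u,x)=\max_{j\le J}g_j(u,x)$ be a maximum of concave functions (in $u$) with domain $\operatorname{dom}_u g=\mathbf{R}^m$ and with polyhedral support $S=\{u\mid Hu\le h\}$, where, at a given $x$, each $g_j$ satisfies a smoothness condition on its domain with respect to the $\ell_2$-norm with constant $L_j$: $\|\nabla g_j(v,x)-\nabla g_j(u,x)\|_2\le L_j\|u-v\|_2$ for all $u,v\in\mathbf{R}^m$ (gradients in the first argument). Then, for the same $x$ and $\epsilon$, $$\bar g^N(x)-\delta(K,z,\gamma)\le\bar g^K(x)\le\bar g^{N*}(x)+\max_{j\le J}\frac{L_j}{2}D(K),$$ where $$\delta(K,z,\gamma)=\frac1N\sum_{k=1}^K\sum_{i\in C_k}\max_{j\le J}\left((-z_{jk}-H^T\gamma_{jk})^T(d_i-\bar d_k)\right)$$ and $z=(z_{jk})$, $\gamma=(\gamma_{jk})$ are the dual variables obtained by solving the problem (K-Dual) defined in the context.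
   Context: For each $j\le J$ and all $x$ in the compact set $\mathcal X\subseteq\mathbf{R}^n$, the function $u\mapsto-g_j(u,x)$ is proper, convex and lower-semicontinuous. Data points $d_1,\dots,d_N\in S$ are partitioned into $K$ disjoint nonempty clusters with index sets $C_1,\dots,C_K$, means $\bar d_k=\frac1{|C_k|}\sum_{i\in C_k}d_i$ and weights $w_k=|C_k|/N$. $\|\cdot\|$ is a norm on $\mathbf{R}^m$ with dual norm $\|\cdot\|_*$, $\epsilon>0$, and $p\ge1$ is an integer. Define (maximization meaning supremum) $$\bar g^K(x)=\max\Big\{\sum_{k=1}^K\sum_{j=1}^J\alpha_{jk}g_j(v_{jk},x)\ :\ \sum_{k=1}^K\sum_{j=1}^J\alpha_{jk}\|v_{jk}-\bar d_k\|^p\le\epsilon^p,\ v_{jk}\in S,\ \alpha_{jk}\ge0,\ \sum_{j=1}^J\alpha_{jk}=w_k\ \forall k\Big\};$$ $\bar g^N(x)$ is the same quantity without clustering (i.e. $K=N$, $w_i=1/N$, centers $d_i$); and $$\bar g^{N*}(x)=\max\Big\{\sum_{i=1}^N\sum_{j=1}^J\alpha_{ji}g_j(v_{ji},x)\ :\ \sum_{i=1}^N\sum_{j=1}^J\alpha_{ji}\|v_{ji}-d_i\|^p\le\epsilon^p,\ v_{ji}\in\mathbf{R}^m,\ \alpha_{ji}\ge0,\ \sum_{j=1}^J\alpha_{ji}=\tfrac1N\ \forall i\Big\}$$ (no support constraint). Also $D(K)=\frac1N\sum_{k=1}^K\sum_{i\in C_k}\|d_i-\bar d_k\|_2^2$.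 The dual versions of the problems for $\bar g^N(x)$ and $\bar g^K(x)$, whose optimal values are likewise written $\bar g^N(x)$ and $\bar g^K(x)$, are given as follows. The problem (K-Dual), with $K$ clusters, is $$\begin{array}{ll}\text{minimize}&\sum_{k=1}^K\frac{|C_k|}{N}s_k\\ \text{subject to}&[-g_j]^*(z_{jk}-H^T\gamma_{jk},x)+\gamma_{jk}^T(h-H\bar d_k)-z_{jk}^T\bar d_k+\lambda\epsilon^p+\phi(q)\lambda\left\|z_{jk}/\lambda\right\|_*^q\le s_k,\quad k=1,\dots,K,\ j=1,\dots,J\end{array}$$ over $\lambda\ge0$, $z_{jk}\in\mathbf{R}^m$, $\gamma_{jk}\ge0$, $s_k\in\mathbf{R}$. The problem (N-Dual), without clustering, is $$\begin{array}{ll}\text{minimize}&\frac1N\sum_{i=1}^Ns_i\\ \text{subject to}&[-g_j]^*(z_{ji}-H^T\gamma_{ji},x)+\gamma_{ji}^T(h-Hd_i)-z_{ji}^Td_i+\phi(q)\lambda\left\|z_{ji}/\lambda\right\|_*^q+\lambda\epsilon^p\le s_i,\quad i=1,\dots,N,\ j=1,\dots,J\end{array}$$ over $\lambda\ge0$, $z_{ji}\in\mathbf{R}^m$, $\gamma_{ji}\ge0$, $s_i\in\mathbf{R}$. Here $1/p+1/q=1$, $\phi(q)=(q-1)^{q-1}/q^q$, and $[-g_j]^*(z,x)=\sup_u\{z^Tu+g_j(u,x)\}$ is the convex conjugate. For $\lambda=0$ the term $\phi(q)\lambda\|z/\lambda\|_*^q$ is $0$ if $z=0$ and $+\infty$ otherwise;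 for $p=1$ ($q=\infty$) it is $0$ if $\|z\|_*\le\lambda$ and $+\infty$ otherwise. *)

(* Defs.v *)
From HB Require Import structures.
From mathcomp Require Import all_boot all_order all_algebra.
From mathcomp Require Import all_classical all_reals all_analysis.
Set Implicit Arguments.
Unset Strict Implicit.
Unset Printing Implicit Defensive.
Import Order.TTheory GRing.Theory Num.Theory.
Import numFieldNormedType.Exports.
Local Open Scope classical_set_scope.
Local Open Scope ring_scope.

Section Euclidean.
Context {R : realType} {m : nat}.
Implicit Types (u v y z : 'cV[R]_m) (nrm : 'cV[R]_m -> R).

Definition dotv u v : R := \sum_(i < m) u i 0 * v i 0.

Definition l2norm u : R := Num.sqrt (dotv u u).

Definition is_norm nrm : Prop :=
  [/\ forall u v, nrm (u + v) <= nrm u + nrm v,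
      forall (a : R) u, nrm (a *: u) = `|a| * nrm u
    & forall u, nrm u = 0 -> u = 0].

(* The set is nonempty and, by equivalence of norms, bounded, so that the real
   [sup] is the true supremum. *)
Definition dual_norm nrm z : R := sup [set dotv z u | u in [set u | nrm u <= 1]].

Definition polyhedron {r : nat} (H : 'M[R]_(r, m)) (h : 'cV[R]_r) :
    set 'cV[R]_m :=
  [set u | forall i, (H *m u) i 0 <= h i 0].

End Euclidean.

Section ExtendedFunctions.
Context {R : realType} {m : nat}.
Implicit Types (f : 'cV[R]_m -> \bar R).

Definition ext_proper f : Prop :=
  (forall u, f u != -oo%E) /\ exists u, (f u < +oo)%E.

(* Only used together with [ext_proper], so the right-hand side is never of the
   form +oo + -oo. *)
Definition ext_convex f : Prop :=
  forall (u v : 'cV[R]_m) (t : R), 0 < t < 1 ->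
    (f (t *: u + (1 - t) *: v)%R <= t%:E * f u + (1 - t)%:E * f v)%E.

(* For a concave function the effective domain is where it exceeds -oo. *)
Definition concave_dom f : set 'cV[R]_m := [set u | (-oo < f u)%E].

Definition fenchel_conjugate f (y : 'cV[R]_m) : \bar R :=
  ereal_sup [set ((dotv y u)%:E - f u)%E | u in [set: 'cV[R]_m]].

Definition gradient (f : 'cV[R]_m -> R) (u : 'cV[R]_m) : 'cV[R]_m :=
  \col_(i < m) 'D_(delta_mx i 0) f u.

(* L-smoothness on all of R^m; the gradient of an extended-real function only
   makes sense where it is finite, hence the first clause. *)
Definition smooth (L : R) f : Prop :=
  [/\ forall u, f u \is a fin_num,
      forall u, differentiable (fine \o f) u
    & forall u v, l2norm (gradient (fine \o f) v - gradient (fine \o f) u)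
                  <= L * l2norm (u - v)].

End ExtendedFunctions.

Definition is_clustering {N K : nat} (C : 'I_K -> {set 'I_N}) : Prop :=
  [/\ forall k, (0 < #|C k|)%N,
      forall k l i, i \in C k -> i \in C l -> k = l
    & forall i, exists k, i \in C k].

Section Clusters.
Context {R : realType} {m N K : nat}.
Variables (d : 'I_N -> 'cV[R]_m) (C : 'I_K -> {set 'I_N}).

Definition cluster_mean (k : 'I_K) : 'cV[R]_m :=
  (#|C k|%:R)^-1 *: \sum_(i in C k) d i.

Definition cluster_weight (k : 'I_K) : R := #|C k|%:R / N%:R.

Definition dispersion : R :=
  N%:R^-1 * \sum_(k < K) \sum_(i in C k) l2norm (d i - cluster_mean k) ^+ 2.

End Clusters.

(* Here [G] is the family of functions u |-> g_j(u, x) at the given x, [c] are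
   the M centers and [w] their weights: cluster means with the cluster weights
   for the clustered problems, data points with weights 1/N otherwise. *)
Section Problems.
Context {R : realType} {m J M : nat}.
Variables (nrm : 'cV[R]_m -> R) (p : nat) (eps : R).
Variables (G : 'I_J -> 'cV[R]_m -> \bar R).
Variables (w : 'I_M -> R) (c : 'I_M -> 'cV[R]_m).

Definition primal_feasible (S : set 'cV[R]_m)
    (alpha : 'I_J -> 'I_M -> R) (v : 'I_J -> 'I_M -> 'cV[R]_m) : Prop :=
  [/\ \sum_(k < M) \sum_(j < J) alpha j k * nrm (v j k - c k) ^+ p <= eps ^+ p,
      forall j k, S (v j k),
      forall j k, 0 <= alpha j k
    & forall k, \sum_(j < J) alpha j k = w k].

Definition primal_value (S : set 'cV[R]_m) : \bar R :=
  ereal_sup [set y | exists alpha v, primal_feasible S alpha v /\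
    y = (\sum_(k < M) \sum_(j < J) (alpha j k)%:E * G j (v j k))%E].

(* The exponent q with 1/p + 1/q = 1, meaningful for p > 1. *)
Definition conj_exponent : R := (1 - p%:R^-1)^-1.

Definition phi (q : R) : R := (q - 1) `^ (q - 1) / q `^ q.

(* phi(q) lambda ||z / lambda||_*^q with its conventions at p = 1 (q = oo) and
   at lambda = 0. *)
Definition norm_term (lambda : R) (z : 'cV[R]_m) : \bar R :=
  if p == 1%N then (if dual_norm nrm z <= lambda then 0%E else +oo%E)
  else if lambda == 0 then (if z == 0 then 0%E else +oo%E)
  else (phi conj_exponent * lambda
        * dual_norm nrm (lambda^-1 *: z) `^ conj_exponent)%:E.

Context {r : nat}.
Variables (H : 'M[R]_(r, m)) (h : 'cV[R]_r).
Implicit Types (lambda : R) (z : 'I_J -> 'I_M -> 'cV[R]_m)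
  (gamma : 'I_J -> 'I_M -> 'cV[R]_r) (s : 'I_M -> R).

(* Pitfall: the multiplier term is gamma^T (h - H c_k), although the conjugate is
   taken at z - H^T gamma without recentering at c_k.  Hence [dual_value] need
   not coincide with [primal_value] on [polyhedron H h]. *)
Definition dual_feasible lambda z gamma s : Prop :=
  [/\ 0 <= lambda,
      forall j k l, 0 <= gamma j k l 0
    & forall k j,
      (fenchel_conjugate (fun u => - G j u) (z j k - H^T *m gamma j k)%R
       + (dotv (gamma j k) (h - H *m c k) - dotv (z j k) (c k)
          + lambda * eps ^+ p)%:E
       + norm_term lambda (z j k) <= (s k)%:E)%E].

Definition dual_objective s : R := \sum_(k < M) w k * s k.

Definition dual_value : \bar R :=
  ereal_inf [set y | exists lambda z gamma s,
    dual_feasible lambda z gamma s /\ y = (dual_objective s)%:E].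

Definition dual_optimal lambda z gamma s : Prop :=
  dual_feasible lambda z gamma s /\
  forall lambda' z' gamma' s', dual_feasible lambda' z' gamma' s' ->
    dual_objective s <= dual_objective s'.

End Problems.

Definition delta {R : realType} {m r J N K : nat}
    (d : 'I_N -> 'cV[R]_m) (C : 'I_K -> {set 'I_N}) (H : 'M[R]_(r, m))
    (z : 'I_J -> 'I_K -> 'cV[R]_m) (gamma : 'I_J -> 'I_K -> 'cV[R]_r) :
    \bar R :=
  ((N%:R^-1)%:E * \sum_(k < K) \sum_(i in C k) \big[maxe/-oo]_(j < J)
    (dotv (- z j k - H^T *m gamma j k)%R (d i - cluster_mean d C k)%R)%:E)%E.

(* Main.v *)
Require Import Defs.
From mathcomp Require Import all_boot all_order all_algebra.
From mathcomp Require Import all_classical all_reals all_analysis.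
From mathcomp Require Import ring lra.
Import Order.TTheory GRing.Theory Num.Theory.
Import numFieldNormedType.Exports.
Local Open Scope classical_set_scope.
Local Open Scope ring_scope.

(** The lower bound is a perturbation of dual constraints. If every data point
    inherits the dual variables of its cluster, the left-hand side of each of its
    constraints moves by a term linear in its deviation from the cluster mean;
    raising the level variable [s] by the largest of these terms gives a feasible
    point of the unclustered dual, and the total increase is exactly [delta]
    ([declustered_dual_value_le]).

    Both upper bounds go through the clustered primal problem. A feasible
    allocation around the cluster means is translated to the data points, each
    point of a cluster receiving an equal share of the mass. Transport costs do
    not change, and, the deviations from a cluster mean summing to zero, the
    descent inequality for L-smooth functions shows that the objective loses at
    most [L / 2] times the dispersion ([clustered_primal_value_le]). The
    translated points may leave the support, whence the unsupported value on the
    right.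

    For the clustered dual value one also needs duality without a gap against the
    unsupported clustered primal ([dual_value_le_primal_value]). The budget is a
    single convex constraint satisfied strictly by the centers, so there is a
    multiplier [lam0] ([primal_multiplier]), obtained by separating slopes in the
    plane of pairs (value, budget). For [lam > lam0] the penalised functions
    [f j v - lam * nrm (v - c k) ^+ p] decay at infinity and have maximisers.
    At a maximiser minus the gradient of [f j] serves as [z]: concavity evaluates
    the conjugate there, and first-order optimality bounds the conjugate of the
    penalty, hence the norm term. Letting [lam] decrease to [lam0] closes the
    gap. Differentiability thus replaces any separation theorem in R^m. *)

Set Implicit Arguments.
Unset Strict Implicit.
Unset Printing Implicit Defensive.

(** * Inner product and differentiation along lines *)

Section Dot.
Context {R : realType} {m : nat}.
Implicit Types u v e : 'cV[R]_m.

Lemma dotvC u v : dotv u v = dotv v u.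
Proof. by apply: eq_bigr => i _; rewrite mulrC. Qed.

Lemma dotvDl u1 u2 v : dotv (u1 + u2) v = dotv u1 v + dotv u2 v.
Proof. by rewrite -big_split; apply: eq_bigr => i _; rewrite mxE mulrDl. Qed.

Lemma dotvDr u v1 v2 : dotv u (v1 + v2) = dotv u v1 + dotv u v2.
Proof. by rewrite !(dotvC u) dotvDl. Qed.

Lemma dotvZl a u v : dotv (a *: u) v = a * dotv u v.
Proof. by rewrite /dotv big_distrr; apply: eq_bigr => i _; rewrite mxE /= mulrA. Qed.

Lemma dotvZr a u v : dotv u (a *: v) = a * dotv u v.
Proof. by rewrite !(dotvC u) dotvZl. Qed.

Lemma dotvNl u v : dotv (- u) v = - dotv u v.
Proof. by rewrite -scaleN1r dotvZl mulN1r. Qed.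

Lemma dotvNr u v : dotv u (- v) = - dotv u v.
Proof. by rewrite -scaleN1r dotvZr mulN1r. Qed.

Lemma dotvBl u1 u2 v : dotv (u1 - u2) v = dotv u1 v - dotv u2 v.
Proof. by rewrite dotvDl dotvNl. Qed.

Lemma dotvBr u v1 v2 : dotv u (v1 - v2) = dotv u v1 - dotv u v2.
Proof. by rewrite dotvDr dotvNr. Qed.

Lemma dotv0l v : dotv 0 v = 0.
Proof. by rewrite -(scale0r 0) dotvZl mul0r. Qed.

Lemma dotv0r v : dotv v 0 = 0.
Proof. by rewrite dotvC dotv0l. Qed.

Lemma dotv_sumr (I : finType) (P : pred I) (F : I -> 'cV[R]_m) u :
  dotv u (\sum_(i | P i) F i) = \sum_(i | P i) dotv u (F i).
Proof. by apply: (big_morph (dotv u)) => [x y|]; rewrite ?dotvDr ?dotv0r. Qed.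

Lemma dotvv_ge0 u : 0 <= dotv u u.
Proof. by apply: sumr_ge0 => i _; rewrite -expr2 sqr_ge0. Qed.

Lemma dotvv_eq0 u : dotv u u = 0 -> u = 0.
Proof.
move=> /eqP; rewrite psumr_eq0 => [/allP h|i _]; last by rewrite -expr2 sqr_ge0.
apply/matrixP => i j; rewrite (ord1 j) mxE.
by have := h i (mem_index_enum i); rewrite /= -expr2 sqrf_eq0 => /eqP.
Qed.

Lemma l2norm_ge0 u : 0 <= l2norm u.
Proof. exact: sqrtr_ge0. Qed.

Lemma sqr_l2norm u : l2norm u ^+ 2 = dotv u u.
Proof. exact: sqr_sqrtr (dotvv_ge0 u). Qed.

Lemma l2normZ (a : R) u : 0 <= a -> l2norm (a *: u) = a * l2norm u.
Proof.
move=> a0; rewrite /l2norm dotvZl dotvZr (_ : a * _ = a ^+ 2 * dotv u u).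
  by rewrite sqrtrM ?sqr_ge0 // sqrtr_sqr ger0_norm.
by rewrite expr2 mulrA.
Qed.

Lemma cauchy_schwarz_dotv u v : dotv u v <= l2norm u * l2norm v.
Proof.
have [u0|u0] := eqVneq (l2norm u) 0.
  have -> : u = 0 by apply: dotvv_eq0; rewrite -sqr_l2norm u0 expr0n.
  by rewrite dotv0l mulr_ge0 ?l2norm_ge0.
have [v0|v0] := eqVneq (l2norm v) 0.
  have -> : v = 0 by apply: dotvv_eq0; rewrite -sqr_l2norm v0 expr0n.
  by rewrite dotv0r mulr_ge0 ?l2norm_ge0.
have ab : 0 < l2norm u * l2norm v.
  by rewrite lt_def mulf_neq0 //= mulr_ge0 ?l2norm_ge0.
have := dotvv_ge0 (l2norm v *: u - l2norm u *: v).
rewrite dotvBl !dotvBr !dotvZl !dotvZr (dotvC v u) -!sqr_l2norm => h.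
rewrite -(ler_pM2l ab); nra.
Qed.

Lemma cV_sum_delta e : e = \sum_(i < m) e i 0 *: delta_mx i 0.
Proof.
by rewrite {1}[e]matrix_sum_delta; apply: eq_bigr => i _; rewrite big_ord1.
Qed.

Lemma derive_gradient (f : 'cV[R]_m -> R) u e :
  differentiable f u -> 'D_e f u = dotv (gradient f u) e.
Proof.
move=> df; rewrite deriveE // {1}(cV_sum_delta e) linear_sum.
apply: eq_bigr => i _.
by rewrite linearZ /= mxE deriveE // mulrC.
Qed.

Lemma is_derive_line (f : 'cV[R]_m -> R) u e (t : R) :
  differentiable f (u + t *: e) ->
  is_derive t 1 (fun s => f (u + s *: e)) (dotv (gradient f (u + t *: e)) e).
Proof.
move=> df; rewrite -derive_gradient //.
have E : (fun s : R => s^-1 *: (((fun r : R => f (u + r *: e)) \o shift t) (s *: 1)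
           - f (u + t *: e))) =
         (fun s : R => s^-1 *: ((f \o shift (u + t *: e)) (s *: e)
           - f (u + t *: e))).
  apply: funext => s /=; congr (_ *: (f _ - _)).
  by rewrite [s *: 1]mulr1 scalerDl addrCA.
split; last by rewrite /derive E.
by rewrite /derivable E; apply: diff_derivable.
Qed.

(** Along the segment the slope drops by at most [L * s * l2norm e ^+ 2], the
    derivative of the quadratic correction; so the corrected restriction to the
    segment has a nonnegative derivative. *)
Lemma smooth_lower_bound (f : 'cV[R]_m -> R) (L : R) :
  (forall u, differentiable f u) ->
  (forall u v, l2norm (gradient f v - gradient f u) <= L * l2norm (u - v)) ->
  forall u e,
  f u + dotv (gradient f u) e - L / 2 * l2norm e ^+ 2 <= f (u + e).
Proof.
move=> df Lf u e.
pose c := dotv (gradient f u) e.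
pose b := L / 2 * l2norm e ^+ 2.
pose psi := (fun s : R => f (u + s *: e)) + ((- c) *: id + b *: (id ^+ 2))
  : R -> R.
have dpsi (t : R) : is_derive t 1 psi
    (dotv (gradient f (u + t *: e)) e + (- c *: 1 + b *: (2 * t))).
  apply: is_deriveD; first exact: is_derive_line.
  apply: is_deriveD; apply: is_deriveZ.
  by apply: is_derive_eq; rewrite expr1 [LHS]mulr1.
have [s] := MVT_segment (@ler01 R) (fun t _ => dpsi t)
   (continuous_subspaceT (fun t => differentiable_continuous
     ((derivable1_diffP _ _).1 (@ex_derive _ _ _ _ _ _ _ (dpsi t))))).
rewrite in_itv /= => /andP[s0 s1].
rewrite /psi !fctE /= scale1r scale0r addr0 subr0 mulr1 => E.
have cs : - dotv (gradient f (u + s *: e)) e + c <= L * s * l2norm e ^+ 2.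
  rewrite -dotvNl -dotvDl addrC.
  apply: le_trans (cauchy_schwarz_dotv _ _) _.
  rewrite expr2 !mulrA; apply: ler_wpM2r; first exact: l2norm_ge0.
  apply: le_trans (Lf _ _) _.
  by rewrite addrAC subrr add0r l2normZ // mulrA.
rewrite expr0n /= in E; rewrite expr1n in E.
rewrite /GRing.scale /= in E.
rewrite -/c -/b; have Eb : L * s * l2norm e ^+ 2 = 2 * s * b by rewrite /b; field.
rewrite Eb in cs; nra.
Qed.

End Dot.

(** * First-order conditions for concave functions *)

Section Concave.
Context {R : realType} {m : nat}.
Implicit Types (u v w e c : 'cV[R]_m) (f h : 'cV[R]_m -> R).

Definition convex_fun h := forall u v (t : R), 0 < t < 1 ->
  h (t *: u + (1 - t) *: v) <= t * h u + (1 - t) * h v.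

Lemma gradient_slope_le f u e (a : R) : differentiable f u ->
  (forall t : R, 0 < t < 1 -> f (u + t *: e) - f u <= t * a) ->
  dotv (gradient f u) e <= a.
Proof.
move=> df fa; rewrite -derive_gradient // /derive.
have cv := diff_derivable (v := e) df.
rewrite cvg_at_rightE //; apply: limr_le.
  apply/cvg_ex; exists (lim ((fun t : R =>
    t^-1 *: ((f \o shift u) (t *: e) - f u)) @ 0^')).
  exact: cvg_dnbhs_at_right cv.
near=> t.
have t0 : 0 < t by near: t; exact: nbhs_right_gt.
have t1 : t < 1 by near: t; exact: nbhs_right_lt.
rewrite -[leLHS]/(t^-1 * (f (t *: e + u) - f u)) mulrC ler_pdivrMr // mulrC.
by rewrite (addrC _ u); apply: fa; rewrite t0.
Unshelve. all: by end_near. Qed.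


Lemma gradient_slope_ge f u e (a : R) : differentiable f u ->
  (forall t : R, 0 < t < 1 -> t * a <= f (u + t *: e) - f u) ->
  a <= dotv (gradient f u) e.
Proof.
move=> df fa; rewrite -lerN2 -derive_gradient // -deriveN ?derive_gradient //.
- apply: gradient_slope_le => [|t t01]; first exact: differentiableN.
  by rewrite !fctE /= mulrN -opprD lerN2 fa.
- exact: differentiableN.
- exact: diff_derivable.
Qed.

Lemma segmentE u v (t : R) : v + t *: (u - v) = t *: u + (1 - t) *: v.
Proof. by rewrite scalerBr scalerBl scale1r addrCA. Qed.

Lemma concave_le_tangent f u v : differentiable f u ->
  convex_fun (fun w => - f w) ->
  f v <= f u + dotv (gradient f u) (v - u).
Proof.
move=> df cf; rewrite -lerBlDl; apply: gradient_slope_ge => // t t01.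
by rewrite segmentE; have := cf v u t t01; lra.
Qed.

(** First-order optimality for a differentiable function penalised by a convex,
    possibly nonsmooth one: the gradient is a subgradient of the penalty. *)
Lemma gradient_le_penalty f h u v : differentiable f u -> convex_fun h ->
  (forall w, f w - h w <= f u - h u) ->
  dotv (gradient f u) (v - u) <= h v - h u.
Proof.
move=> df ch umax; apply: gradient_slope_le => // t t01; rewrite segmentE.
by have := ch v u t t01; have := umax (t *: v + (1 - t) *: u); lra.
Qed.

End Concave.

(** By induction on [p]: the mean of the products [a * a ^+ p] and [b * b ^+ p]
    exceeds the product of the means by
    [t * (1 - t) * ((a - b) * (a ^+ p - b ^+ p))], which is nonnegative. *)
Lemma convex_exprn {R : realType} (a b t : R) p : 0 <= a -> 0 <= b -> 0 < t < 1 ->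
  (t * a + (1 - t) * b) ^+ p <= t * a ^+ p + (1 - t) * b ^+ p.
Proof.
move=> a0 b0 /andP[t0 t1]; elim: p => [|p IH]; first by rewrite !expr0; lra.
rewrite !exprS.
have ab : 0 <= (a - b) * (a ^+ p - b ^+ p).
  have [le|/ltW le] := leP a b.
    by rewrite mulr_le0 // subr_le0 // lerXn2r.
  by rewrite mulr_ge0 // subr_ge0 // lerXn2r.
apply: le_trans (ler_wpM2l _ IH) _; first by nra.
have : 0 <= t * (1 - t) * ((a - b) * (a ^+ p - b ^+ p)).
  by rewrite mulr_ge0 // mulr_ge0 //; lra.
lra.
Qed.

(** * Norms on R^m and maximisers of coercive functions *)

Section Norms.
Context {R : realType} {m : nat} (nrm : 'cV[R]_m -> R).
Hypothesis nrmP : is_norm nrm.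
Implicit Types (u v w c : 'cV[R]_m).

Lemma is_normD u v : nrm (u + v) <= nrm u + nrm v. Proof. by case: nrmP. Qed.
Lemma is_normZ a u : nrm (a *: u) = `|a| * nrm u. Proof. by case: nrmP. Qed.

Lemma is_norm0 : nrm 0 = 0.
Proof. by rewrite -(scale0r 0) is_normZ normr0 mul0r. Qed.

Lemma is_normN u : nrm (- u) = nrm u.
Proof. by rewrite -scaleN1r is_normZ normrN1 mul1r. Qed.

Lemma is_norm_ge0 u : 0 <= nrm u.
Proof.
by have := is_normD u (- u); rewrite subrr is_norm0 is_normN -mulr2n pmulrn_lge0.
Qed.

Lemma convex_norm_power (lam : R) c p : 0 <= lam ->
  convex_fun (fun v => lam * nrm (v - c) ^+ p).
Proof.
move=> lam0 u v t t01; have /andP[t0 t1] := t01.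
rewrite !(mulrCA _ lam) -mulrDr; apply: ler_wpM2l => //.
apply: le_trans (convex_exprn _ (is_norm_ge0 _) (is_norm_ge0 _) t01).
apply: lerXn2r; rewrite ?nnegrE ?is_norm_ge0 //.
  by rewrite addr_ge0 // mulr_ge0 ?is_norm_ge0 //; lra.
have -> : t *: u + (1 - t) *: v - c = t *: (u - c) + (1 - t) *: (v - c).
  by rewrite !scalerBr addrACA -opprD -scalerDl addrCA subrr addr0 scale1r.
apply: le_trans (is_normD _ _) _.
by rewrite !is_normZ !ger0_norm //; lra.
Qed.

Lemma entry_le_norm u i : `|u i 0| <= `|u|.
Proof.
rewrite [leRHS]/Num.Def.normr /= mx_normrE.
by apply/bigmax_geP; right => /=; exists (i, 0).
Qed.

Lemma is_norm_le_norm : exists2 b : R, 0 < b & forall u, nrm u <= b * `|u|.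
Proof.
exists (1 + \sum_(i < m) nrm (delta_mx i 0)).
  by rewrite ltr_pwDl // sumr_ge0 // => i _; exact: is_norm_ge0.
move=> u; rewrite {1}(cV_sum_delta u) mulrDl mul1r -[leLHS]add0r lerD //.
rewrite mulr_suml.
elim/big_ind2 : _ => [|x a y b' xa yb|i _]; first by rewrite is_norm0.
  by apply: le_trans (is_normD _ _) _; rewrite lerD.
by rewrite is_normZ mulrC ler_wpM2l ?is_norm_ge0 // entry_le_norm.
Qed.

Lemma is_norm_continuous : continuous nrm.
Proof.
have [b b0 nrmb] := is_norm_le_norm.
move=> u; apply/(@cvgrPdist_lt _ R^o _ (nbhs u)) => e e0; near=> v.
apply: (@le_lt_trans _ _ (nrm (u - v))).
  have := is_normD (u - v) v; have := is_normD (v - u) u.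
  rewrite !subrK -(is_normN (v - u)) opprB => h1 h2.
  by rewrite ler_norml; apply/andP; split; lra.
apply: le_lt_trans (nrmb _) _; rewrite mulrC -ltr_pdivlMr //.
by near: v; apply: cvgr_dist_lt => //; rewrite divr_gt0.
Unshelve. all: by end_near. Qed.

End Norms.

Section Coercive.
Context {R : realType} {m : nat}.
Implicit Types (u v w c : 'cV[R]_m).

Lemma trmx_norm p q (A : 'M[R]_(p, q)) : `|A^T| = `|A|.
Proof.
have le k l (B : 'M[R]_(k, l)) : `|B^T| <= `|B|.
  rewrite [leLHS]/Num.Def.normr /= mx_normrE; apply/bigmax_leP; split => // -[i j] _ /=.
  rewrite mxE [leRHS]/Num.Def.normr /= mx_normrE.
  by apply/bigmax_geP; right => /=; exists (j, i).
by apply/eqP; rewrite eq_le le /= -{1}(trmxK A) le.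
Qed.

Lemma trmx_continuous p q : continuous (@trmx R p q).
Proof.
move=> A; apply/(@cvgrPdist_lt _ _ _ (nbhs A)) => e e0; near=> B.
by rewrite -raddfB /= trmx_norm; near: B; exact: cvgr_dist_lt.
Unshelve. all: by end_near. Qed.

(** Transposition is an isometry onto row vectors, where bounded closed sets are
    compact. *)
Lemma cV_bounded_closed_compact (A : set 'cV[R]_m) :
  bounded_set A -> closed A -> compact A.
Proof.
move=> bA cA; have -> : A = trmx @` (trmx @^-1` A).
  rewrite image_preimage // eqEsubset; split=> // u _; exists u^T => //.
  exact: trmxK.
apply: continuous_compact.
  by apply: continuous_subspaceT; exact: trmx_continuous.
apply: bounded_closed_compact.
  case: bA => M [Mr MA]; exists M; split => // x Mx u Au /=.
  by rewrite -trmx_norm; exact: (MA x Mx _ Au).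
by apply: preimage_closed => // u _; exact: trmx_continuous.
Qed.

Lemma continuous_coercive_max (F : 'cV[R]_m -> R) c (rad : R) :
  continuous F -> (forall v, rad < `|v| -> F v <= F c) ->
  exists u, forall v, F v <= F u.
Proof.
move=> cF Frad; pose A := [set v : 'cV[R]_m | `|v| <= Num.max rad `|c|].
have Ac : c \in A by rewrite inE /A /= le_max lexx orbT.
have [||u uA umax] := @compact_EVT_max _ R F A _ _ (continuous_subspaceT cF).
- by exists c; rewrite inE in Ac.
- apply: cV_bounded_closed_compact.
    exists (Num.max rad `|c|); split; first exact: num_real.
    by move=> x Mx v /= /le_trans; apply; exact: ltW.
  apply: (@preimage_closed _ _ (fun v : 'cV[R]_m => `|v|) [set x : R | x <= _]).
    by move=> v _; exact: norm_continuous.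
  exact: closed_le.
- exists u => v; have [|vr] := boolP (v \in A); first exact: umax.
  apply: le_trans (umax c Ac); apply: Frad.
  by move: vr; rewrite notin_setE /A /= => /negP; rewrite -ltNge gt_max => /andP[].
Qed.

(** The constant is the minimum of [nrm] on the unit sphere, positive by
    compactness; for [m = 0] the sphere is empty and any constant does. *)
Lemma norm_le_is_norm (nrm : 'cV[R]_m -> R) : is_norm nrm ->
  exists2 b : R, 0 < b & forall u, b * `|u| <= nrm u.
Proof.
move=> nrmP; pose A := [set v : 'cV[R]_m | `|v| = 1].
have cA : compact A.
  apply: cV_bounded_closed_compact.
    exists 1; split; first exact: num_real.
    by move=> x Mx v /= ->; exact: ltW.
  apply: (@preimage_closed _ _ (fun v : 'cV[R]_m => `|v|) [set x : R | x = _]).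
    by move=> v _; exact: norm_continuous.
  exact: closed_eq.
have normalize u : u != 0 -> A (`|u|^-1 *: u).
  by move=> u0; rewrite /A /= normrZ normfV normr_id mulVf // normr_eq0.
have [[u0 Au0]|A0] := pselect (A !=set0); last first.
  exists 1 => // u; have [->|un0] := eqVneq u 0.
    by rewrite normr0 mulr0 is_norm_ge0.
  by case: A0; exists (`|u|^-1 *: u); exact: normalize.
have [||u uA umin] := @compact_EVT_min _ R nrm A _ cA.
- by exists u0.
- exact/continuous_subspaceT/is_norm_continuous.
- rewrite inE in uA; have un : nrm u != 0.
    case: nrmP => _ _ n0; apply/eqP => /n0 u00.
    by move: uA; rewrite /A /= u00 normr0 => /esym/eqP; rewrite oner_eq0.
  exists (nrm u) => [|v]; first by rewrite lt_def un is_norm_ge0.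
  have [->|v0] := eqVneq v 0; first by rewrite normr0 mulr0 is_norm_ge0.
  have v1 : 0 < `|v| by rewrite normr_gt0.
  have := umin (`|v|^-1 *: v); rewrite inE => /(_ (normalize _ v0)).
  by rewrite is_normZ // ger0_norm ?invr_ge0 // mulrC ler_pdivlMr.
Qed.

(** With the smaller multiplier [l] the penalised function is merely bounded; the
    excess [l' - l] makes it decay at infinity, so its maximum is reached. *)
Lemma penalised_max (nrm : 'cV[R]_m -> R) (f : 'cV[R]_m -> R) c p (l l' M : R) :
  is_norm nrm -> continuous f -> (0 < p)%N -> l < l' ->
  (forall v, f v - l * nrm (v - c) ^+ p <= M) ->
  exists u, forall v,
    f v - l' * nrm (v - c) ^+ p <= f u - l' * nrm (u - c) ^+ p.
Proof.
move=> nrmP cf p0 ll' fM; pose F v := f v - l' * nrm (v - c) ^+ p.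
have [b b0 nrmb] := norm_le_is_norm nrmP.
(* Beyond this radius [nrm (v - c)] exceeds both 1, so that its [p]-th power
   dominates it, and the value needed to bring [F v] below [F c]. *)
pose rad := `|c| + b^-1 * (1 + `|M - f c| / (l' - l)).
apply: (@continuous_coercive_max F c rad).
  move=> u; apply: (@cvgB _ R^o _ (nbhs u) _ f); first exact: cf.
  apply: (@cvgMl_tmp _ _ (nbhs u)).
  have cn : {for u, continuous (fun v => nrm (v - c))}.
    apply: (@continuous_comp _ _ _ (fun v => v - c) nrm).
      by apply: (@cvgB _ _ _ (nbhs u)); [exact: cvg_id|exact: cvg_cst].
    exact: is_norm_continuous.
  exact: (continuous_comp cn (@exprn_continuous _ _ _)).
move=> v radv; rewrite /F subrr is_norm0 // expr0n (gtn_eqF p0) mulr0 subr0.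
have e0 : 0 < l' - l by rewrite subr_gt0.
set x := nrm (v - c).
have xge : 1 + `|M - f c| / (l' - l) <= x.
  apply: le_trans (nrmb _); rewrite -ler_pdivrMl //.
  have := ler_distD c v 0; rewrite !subr0 => h.
  by move: radv; rewrite /rad; lra.
have x1 : 1 <= x.
  by apply: le_trans xge; rewrite lerDl divr_ge0 // ltW.
have xp : x <= x ^+ p by apply: ler_eXnr.
have h1 : `|M - f c| <= (l' - l) * x.
  by rewrite mulrC -ler_pdivrMr //; apply: le_trans xge; rewrite lerDr.
have h2 := ler_norm (M - f c).
have h3 : (l' - l) * x <= (l' - l) * x ^+ p by rewrite ler_pM2l.
by have := fM v; rewrite -/x; lra.
Qed.

End Coercive.

(** * The conjugate of a power of a norm *)

Section NormTerm.
Context {R : realType} {m : nat} (nrm : 'cV[R]_m -> R).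
Hypothesis nrmP : is_norm nrm.

Lemma dual_norm_le z (a : R) : (forall u, nrm u <= 1 -> dotv z u <= a) ->
  dual_norm nrm z <= a.
Proof.
move=> za; apply: ge_sup => [|_ [u /= u1 <-]]; last exact: za.
by exists (dotv z 0), 0 => //=; rewrite is_norm0 ?ler01.
Qed.

Lemma dual_norm_ge0 z (a : R) : (forall u, nrm u <= 1 -> dotv z u <= a) ->
  0 <= dual_norm nrm z.
Proof.
move=> za; have ub : has_ubound [set dotv z u | u in [set u | nrm u <= 1]].
  by exists a => _ [u /= u1 <-]; exact: za.
apply: (ub_le_sup ub); exists 0; last exact: dotv0r.
by rewrite /= is_norm0 // ler01.
Qed.

(** On a ray of nearly optimal direction the conjugate of [nrm ^+ p] reduces to
    the maximum of [t * a - t ^+ p], with [a] the dual norm. It is reached at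
    [t = (a / p) ^ (q - 1)], and [phi q] is the constant this produces. *)
Lemma phi_conjugate (p : nat) (a : R) : (1 < p)%N -> 0 < a ->
  let q := conj_exponent p : R in
  exists2 t, 0 < t & phi q * a `^ q = t * a - t ^+ p.
Proof.
move=> p1 a0 q.
have P1 : 1 < p%:R :> R by rewrite ltr1n.
have P0 : 0 < p%:R :> R by lra.
have Pn : p%:R != 0 :> R by rewrite gt_eqF.
have Pn1 : p%:R - 1 != 0 :> R by rewrite gt_eqF //; lra.
have qE : q = p%:R / (p%:R - 1).
  by rewrite /q /conj_exponent; field; rewrite Pn1 Pn.
have q1E : q - 1 = (p%:R - 1)^-1 by rewrite qE; field.
have q1 : 0 < q - 1 by rewrite q1E invr_gt0; lra.
have qp : q = p%:R * (q - 1) by rewrite q1E.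
set b := a / p%:R; have b0 : 0 < b by rewrite divr_gt0.
exists (b `^ (q - 1)); first exact: powR_gt0.
have -> : (b `^ (q - 1)) ^+ p = b `^ q.
  by rewrite -powR_mulrn ?powR_ge0 // -powRrM mulrC -qp.
have split1 (y : R) : 0 < y -> y `^ q = y * y `^ (q - 1).
  move=> y0; rewrite -{2}(powRr1 (ltW y0)) -powRD; last by rewrite (gt_eqF y0) implybT.
  by rewrite addrC subrK.
have -> : b `^ (q - 1) * a = p%:R * b `^ q.
  by rewrite (split1 b) // /b; field.
have -> : a `^ q = p%:R `^ q * b `^ q.
  by rewrite -powRM ?ltW // /b mulrC divfK.
have -> : phi q = (p%:R - 1) / p%:R `^ q.
  rewrite /phi.
  have -> : q `^ q = p%:R `^ q * ((q - 1) * (q - 1) `^ (q - 1)).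
    by rewrite -(split1 _ q1) -powRM ?ltW // -qp.
  have h1 : (q - 1) `^ (q - 1) != 0 by rewrite gt_eqF // powR_gt0.
  have h2 : p%:R `^ q != 0 by rewrite gt_eqF // powR_gt0.
  have -> : p%:R - 1 = (q - 1)^-1 by rewrite q1E invrK.
  by field; rewrite h1 h2 (lt0r_neq0 q1).
have h2 : p%:R `^ q != 0 by rewrite gt_eqF // powR_gt0.
by field.
Qed.

(** The norm term is at most the conjugate of [lam * nrm ^+ p] at [z], seen by
    restricting that conjugate to rays. The hypothesis also bounds the set whose
    real supremum is the dual norm, so that this supremum is the true one. *)
Lemma norm_term_le (p : nat) (lam B : R) z : (0 < p)%N -> 0 < lam ->
  (forall e, dotv z e - lam * nrm e ^+ p <= B) ->
  (norm_term nrm p lam z <= B%:E)%E.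
Proof.
move=> p0 lam0 zB; rewrite /norm_term.
have B0 : 0 <= B.
  by have := zB 0; rewrite dotv0r is_norm0 // expr0n (gtn_eqF p0) mulr0 subr0.
have ray (t : R) u : 0 <= t -> nrm u <= 1 -> t * dotv z u - lam * t ^+ p <= B.
  move=> t0 u1; apply: le_trans (zB (t *: u)); rewrite dotvZr lerD2l lerN2.
  rewrite ler_pM2l // is_normZ // ger0_norm //.
  by rewrite lerXn2r ?nnegrE ?mulr_ge0 ?is_norm_ge0 // ler_piMr.
have [p1|pn1] := eqVneq p 1%N.
  rewrite ifT //; apply: dual_norm_le => u u1; rewrite leNgt; apply/negP => zu.
  (* On this ray the left-hand side of [ray] is [B + 1]. *)
  have d0 : 0 < dotv z u - lam by rewrite subr_gt0.
  have := ray ((B + 1) / (dotv z u - lam)) u _ u1.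
  rewrite p1 expr1 (mulrC lam) -mulrBr divfK ?gt_eqF //.
  by move=> /(_ (divr_ge0 (addr_ge0 B0 ler01) (ltW d0))); lra.
rewrite (gt_eqF lam0) lee_fin.
have {}pn1 : (1 < p)%N by rewrite ltn_neqAle eq_sym pn1.
set y := lam^-1 *: z; set a := dual_norm nrm y.
have rayy (t : R) u : 0 < t -> nrm u <= 1 -> dotv y u <= (B / lam + t ^+ p) / t.
  move=> t0 u1; rewrite ler_pdivlMr // /y dotvZl -mulrA mulrC -ler_pdivlMr ?invr_gt0 //.
  rewrite invrK mulrDl divfK ?gt_eqF // mulrC.
  by have := ray t u (ltW t0) u1; lra.
have a_le (t : R) : 0 < t -> lam * (t * a - t ^+ p) <= B.
  move=> t0; rewrite mulrC -ler_pdivlMr // lerBlDr mulrC -ler_pdivlMr //.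
  by apply: dual_norm_le => u; exact: rayy.
have a0 : 0 <= a by apply: dual_norm_ge0 => u; exact: rayy ltr01.
have [->|an0] := eqVneq a 0.
  have P1 : 1 < p%:R :> R by rewrite ltr1n.
  rewrite powR0 ?mulr0 // /conj_exponent invr_eq0 subr_eq0 eq_sym.
  by rewrite invr_eq1 gt_eqF.
have [|t t0 phiE] := phi_conjugate pn1 (a := a); first by rewrite lt_def an0.
by rewrite [_ * lam]mulrC -mulrA phiE; exact: a_le.
Qed.

End NormTerm.

(** * A Lagrange multiplier for one constraint *)

Section Lagrange.
Context {R : realType}.

(** Concavity of the value function makes every slope to the right of [E] at most
    every slope to its left, so the supremum of the former is a multiplier. *)
Lemma lagrange_multiplier (Q : set (R * R)) (V E : R) :
  (forall x y (t : R), Q x -> Q y -> 0 < t < 1 -> exists z,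
    [/\ Q z, t * x.1 + (1 - t) * y.1 <= z.1 & z.2 <= t * x.2 + (1 - t) * y.2]) ->
  (exists2 x, Q x & x.2 < E) ->
  (forall x, Q x -> x.2 <= E -> x.1 <= V) ->
  exists2 lam, 0 <= lam & forall x, Q x -> x.1 - V <= lam * (x.2 - E).
Proof.
move=> Qconv [x0 Qx0 x0E] QV.
(* 0 is included to keep the multiplier nonnegative, and the set nonempty when
   no element of [Q] lies to the right of [E]. *)
pose Z := [set s : R | s = 0 \/
  exists x, [/\ Q x, E < x.2 & s = (x.1 - V) / (x.2 - E)]].
have Zub y : Q y -> y.2 < E -> ubound Z ((V - y.1) / (E - y.2)).
  move=> Qy yE s [->|[x [Qx xE ->]]].
    by rewrite divr_ge0 // subr_ge0; [apply: QV => //; exact: ltW|exact: ltW].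
  have d1 : 0 < x.2 - E by rewrite subr_gt0.
  have d2 : 0 < E - y.2 by rewrite subr_gt0.
  have d3 : 0 < x.2 - y.2 by lra.
  (* the weight for which the combined second coordinate is exactly [E] *)
  pose t := (E - y.2) / (x.2 - y.2).
  have t1 : 1 - t = (x.2 - E) / (x.2 - y.2).
    by rewrite /t; field; rewrite gt_eqF.
  have t01 : 0 < t < 1 by rewrite divr_gt0 //= -subr_gt0 t1 divr_gt0.
  have [z [Qz z1 z2]] := Qconv x y t Qx Qy t01.
  have tE : t * x.2 + (1 - t) * y.2 = E by rewrite t1 /t; field; rewrite gt_eqF.
  have zE : z.2 <= E by rewrite -tE.
  have := le_trans z1 (QV z Qz zE); rewrite t1 /t => h.
  rewrite ler_pdivrMr // mulrAC ler_pdivlMr //.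
  by move: h; rewrite mulrAC (mulrAC _ _ y.1) -mulrDl ler_pdivrMr //; lra.
have Zne : Z !=set0 by exists 0; left.
have Zb : has_ubound Z by exists ((V - x0.1) / (E - x0.2)); exact: Zub.
exists (sup Z); first by apply: ub_le_sup => //; left.
move=> x Qx; case: (ltgtP x.2 E) => xE.
- rewrite -lerN2 -mulrN !opprB -ler_pdivlMr ?subr_gt0 //.
  by apply: ge_sup => //; exact: Zub.
- rewrite -ler_pdivrMr ?subr_gt0 //; apply: ub_le_sup => //.
  by right; exists x.
- by rewrite xE subrr mulr0 subr_le0 QV // xE.
Qed.

End Lagrange.

Section WeightedAverage.
Context {R : realType} {m : nat}.
Implicit Types (u v : 'cV[R]_m) (h : 'cV[R]_m -> R).

(** When both weights vanish this is 0, and the inequality below is [0 <= 0]. *)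
Definition wavg (a b : R) u v := (a + b)^-1 *: (a *: u + b *: v).

Lemma convex_wavg h (a b : R) u v : convex_fun h -> 0 <= a -> 0 <= b ->
  (a + b) * h (wavg a b u v) <= a * h u + b * h v.
Proof.
move=> ch a0 b0; rewrite /wavg.
have [->|an0] := eqVneq a 0.
  rewrite !add0r scale0r add0r mul0r add0r.
  have [->|bn0] := eqVneq b 0; first by rewrite !mul0r.
  by rewrite scalerA mulVf // scale1r.
have [->|bn0] := eqVneq b 0.
  by rewrite addr0 scale0r addr0 mul0r addr0 scalerA mulVf // scale1r.
have ap : 0 < a by rewrite lt_def an0.
have bp : 0 < b by rewrite lt_def bn0.
have ab : 0 < a + b by rewrite addr_gt0.
have t1 : 1 - (a + b)^-1 * a = (a + b)^-1 * b by field; rewrite gt_eqF.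
have := ch u v ((a + b)^-1 * a).
rewrite t1 mulr_gt0 ?invr_gt0 //= -subr_gt0 t1 mulr_gt0 ?invr_gt0 // => /(_ isT).
rewrite -!mulrA -mulrDr ler_pdivlMl // => h1.
by rewrite scalerDr !scalerA.
Qed.

End WeightedAverage.

(** * Duality for the unsupported problem *)

Lemma exists_argmax {R : realType} {I : finType} (i0 : I) (F : I -> R) :
  exists i, forall j, F j <= F i.
Proof.
exists [arg max_(i > i0) F i]%O.
by case: Order.TotalTheory.arg_maxP => // i _ imax j; exact: imax.
Qed.

Lemma bigmaxe_argmax {R : realType} {I : finType} (F : I -> R) i :
  (forall j, F j <= F i) -> (\big[maxe/-oo]_j (F j)%:E = (F i)%:E)%E.
Proof.
move=> imax; apply/eqP; rewrite eq_le; apply/andP; split.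
  by apply: bigmax_le => [|j _]; [exact: leNye|rewrite lee_fin].
exact: (le_bigmax _ (fun j => (F j)%:E)).
Qed.

Section Duality.
Context {R : realType} {m J M : nat}.
Variables (nrm : 'cV[R]_m -> R) (p : nat) (eps : R).
Variables (f : 'I_J -> 'cV[R]_m -> R).
Variables (w : 'I_M -> R) (c : 'I_M -> 'cV[R]_m).
Hypothesis nrmP : is_norm nrm.

Local Notation G := (fun j u => (f j u)%:E).

Definition allocation (alpha : 'I_J -> 'I_M -> R) : Prop :=
  (forall j k, 0 <= alpha j k) /\ (forall k, \sum_(j < J) alpha j k = w k).

Definition weighted_sum (alpha : 'I_J -> 'I_M -> R) (F : 'I_J -> 'I_M -> R) : R :=
  \sum_(k < M) \sum_(j < J) alpha j k * F j k.

Lemma primal_value_ge S alpha v :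
  primal_feasible nrm p eps w c S alpha v ->
  ((weighted_sum alpha (fun j k => f j (v j k)))%:E
   <= primal_value nrm p eps G w c S)%E.
Proof.
move=> fv; apply: ereal_sup_ubound; exists alpha, v; split => //.
rewrite /weighted_sum -sumEFin; apply: eq_bigr => k _; rewrite -sumEFin.
by apply: eq_bigr => j _; rewrite EFinM.
Qed.

Lemma primal_value_le S (y : \bar R) :
  (forall alpha v, primal_feasible nrm p eps w c S alpha v ->
    ((weighted_sum alpha (fun j k => f j (v j k)))%:E <= y)%E) ->
  (primal_value nrm p eps G w c S <= y)%E.
Proof.
move=> fy; apply: ge_ereal_sup => _ [alpha [v [fv ->]]].
apply: le_trans (fy _ _ fv); rewrite /weighted_sum -sumEFin.
rewrite le_eqVlt; apply/orP; left; apply/eqP; apply: eq_bigr => k _.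
by rewrite -sumEFin; apply: eq_bigr => j _; rewrite EFinM.
Qed.

(** Allocations that give the whole weight of each center to one index; testing
    the Lagrangian inequality on them bounds the maximum over the indices. *)
Definition pure (jj : 'I_M -> 'I_J) (j : 'I_J) (k : 'I_M) : R :=
  if j == jj k then w k else 0.

Lemma weighted_sum_pure jj F : weighted_sum (pure jj) F = \sum_(k < M) w k * F (jj k) k.
Proof.
apply: eq_bigr => k _; rewrite (bigD1 (jj k)) //= /pure eqxx big1 ?addr0 //.
by move=> j /negbTE ->; rewrite mul0r.
Qed.

Hypothesis w_gt0 : forall k, 0 < w k.

Lemma allocation_pure jj : allocation (pure jj).
Proof.
split=> [j k|k]; first by rewrite /pure; case: ifP => // _; exact: ltW.
by rewrite /pure -big_mkcond big_pred1_eq.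
Qed.

Hypotheses (p_gt0 : (0 < p)%N) (eps_gt0 : 0 < eps) (J_gt0 : (0 < J)%N).
Hypothesis w_sum : \sum_(k < M) w k = 1.
Hypothesis f_diff : forall j u, differentiable (f j) u.
Hypothesis f_concave : forall j, convex_fun (fun u => - f j u).

Let cost (v : 'I_J -> 'I_M -> 'cV[R]_m) j k := nrm (v j k - c k) ^+ p.

(** Mixing two allocations and averaging their points with the corresponding
    weights loses neither value nor budget, as the summands are perspectives of
    a concave and of a convex function. *)
Lemma allocation_mix alpha beta u v (t : R) : 0 < t < 1 ->
  allocation alpha -> allocation beta ->
  exists gam x, [/\ allocation gam,
    t * weighted_sum alpha (fun j k => f j (u j k))
      + (1 - t) * weighted_sum beta (fun j k => f j (v j k))
      <= weighted_sum gam (fun j k => f j (x j k))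
    & weighted_sum gam (cost x)
      <= t * weighted_sum alpha (cost u) + (1 - t) * weighted_sum beta (cost v)].
Proof.
move=> /andP[t0 t1] [a0 aw] [b0 bw].
pose a j k := t * alpha j k; pose b j k := (1 - t) * beta j k.
have a0' j k : 0 <= a j k by rewrite mulr_ge0 // ltW.
have b0' j k : 0 <= b j k by rewrite mulr_ge0 // subr_ge0 ltW.
exists (fun j k => a j k + b j k), (fun j k => wavg (a j k) (b j k) (u j k) (v j k)).
split.
- split=> [j k|k]; first exact: addr_ge0.
  by rewrite big_split /= -!mulr_sumr aw bw -mulrDl addrC subrK mul1r.
- rewrite !mulr_sumr -big_split; apply: ler_sum => k _ /=.
  rewrite !mulr_sumr -big_split; apply: ler_sum => j _ /=; rewrite !mulrA.
  have := convex_wavg (u j k) (v j k) (@f_concave j) (a0' j k) (b0' j k).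
  by rewrite -/(a j k) -/(b j k); lra.
- rewrite !mulr_sumr -big_split; apply: ler_sum => k _ /=.
  rewrite !mulr_sumr -big_split; apply: ler_sum => j _ /=; rewrite !mulrA.
  have := convex_wavg (u j k) (v j k)
    (convex_norm_power nrmP (c k) p ler01) (a0' j k) (b0' j k).
  by rewrite !mul1r.
Qed.

(** The centers themselves cost nothing, so the budget constraint is satisfied
    strictly and a multiplier exists. *)
Lemma primal_multiplier (V : R) :
  (forall alpha v, primal_feasible nrm p eps w c setT alpha v ->
    weighted_sum alpha (fun j k => f j (v j k)) <= V) ->
  exists2 lam, 0 <= lam & forall (jj : 'I_M -> 'I_J) (vv : 'I_M -> 'cV[R]_m),
    \sum_(k < M) w k * (f (jj k) (vv k) - lam * nrm (vv k - c k) ^+ p)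
    <= V - lam * eps ^+ p.
Proof.
move=> fV.
pose Q : set (R * R) := [set x | exists alpha v, allocation alpha /\
  x = (weighted_sum alpha (fun j k => f j (v j k)), weighted_sum alpha (cost v))].
have [||x [alpha [v [[a0 aw] ->]]] /= xE|lam lam0 Qlam] :=
    @lagrange_multiplier R Q V (eps ^+ p).
- move=> _ _ t [alpha [u [aA ->]]] [beta [v [bA ->]]] t01 /=.
  have [gam [x [gA h1 h2]]] := allocation_mix u v t01 aA bA.
  exists (weighted_sum gam (fun j k => f j (x j k)), weighted_sum gam (cost x)).
  by split => //; exists gam, x.
- pose jj (_ : 'I_M) := Ordinal J_gt0.
  exists (weighted_sum (pure jj) (fun j k => f j (c k)),
          weighted_sum (pure jj) (cost (fun _ k => c k))).
    by exists (pure jj), (fun _ k => c k); split => //; exact: allocation_pure.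
  rewrite /= weighted_sum_pure big1 ?exprn_gt0 // => k _.
  by rewrite /cost subrr is_norm0 // expr0n (gtn_eqF p_gt0) mulr0.
- by apply: fV; split.
- exists lam => // jj vv.
  have Qjj : Q (weighted_sum (pure jj) (fun j k => f j (vv k)),
                weighted_sum (pure jj) (cost (fun _ => vv))).
    by exists (pure jj), (fun _ => vv); split => //; exact: allocation_pure.
  have := Qlam _ Qjj; rewrite /= !weighted_sum_pure mulrBr => h.
  have -> : \sum_(k < M) w k * (f (jj k) (vv k) - lam * nrm (vv k - c k) ^+ p)
    = \sum_(k < M) w k * f (jj k) (vv k)
      - lam * \sum_(k < M) w k * cost (fun _ => vv) (jj k) k.
    rewrite mulr_sumr -sumrB; apply: eq_bigr => k _.
    by rewrite mulrBr mulrCA.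
  by lra.
Qed.

(** By concavity the supremum defining the conjugate at minus the gradient is
    reached at the point where the gradient is taken. *)
Lemma conjugate_at_gradient j u :
  (fenchel_conjugate (fun v => - (f j v)%:E) (- gradient (f j) u)
   <= (f j u - dotv (gradient (f j) u) u)%:E)%E.
Proof.
apply: ge_ereal_sup => _ [v _ <-]; rewrite oppeK -EFinD lee_fin dotvNl.
by have := concave_le_tangent v (@f_diff j u) (@f_concave j); rewrite dotvBr; lra.
Qed.

Context {r : nat}.
Variables (H : 'M[R]_(r, m)) (h : 'cV[R]_r).

(** The level required of [s] is the penalised maximum: the linear terms that the
    bounds on the conjugate and on the norm term contribute cancel. *)
Lemma dual_feasible_of_maximisers (lam : R) (u : 'I_J -> 'I_M -> 'cV[R]_m) s :
  0 < lam ->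
  (forall j k v, f j v - lam * nrm (v - c k) ^+ p
                 <= f j (u j k) - lam * nrm (u j k - c k) ^+ p) ->
  (forall j k, f j (u j k) - lam * nrm (u j k - c k) ^+ p + lam * eps ^+ p <= s k) ->
  dual_feasible nrm p eps G c H h lam
    (fun j k => - gradient (f j) (u j k)) (fun _ _ => 0) s.
Proof.
move=> lam0 umax us; split=> [||k j]; first exact: ltW.
  by move=> j k l; rewrite mxE.
rewrite mulmx0 subr0 dotv0l add0r.
set z := - gradient (f j) (u j k).
set P := lam * nrm (u j k - c k) ^+ p.
have nt : (norm_term nrm p lam z <= (dotv z (c k - u j k) - P)%:E)%E.
  apply: norm_term_le => // e.
  have := gradient_le_penalty (c k - e) (@f_diff j (u j k))
            (convex_norm_power nrmP (c k) p (ltW lam0)) (@umax j k).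
  rewrite (_ : c k - e - c k = - e); last by rewrite addrAC subrr add0r.
  by rewrite is_normN // /z !dotvNl -/P !dotvBr; lra.
apply: le_trans (leeD (leeD (conjugate_at_gradient j (u j k)) (le_refl _)) nt) _.
rewrite -!EFinD lee_fin; apply: le_trans (us j k).
by rewrite /z -/P dotvBr !dotvNl; lra.
Qed.

(** The primal budget multiplier only makes the penalised functions bounded; any
    larger multiplier makes them attain their maximum, and then minus the
    gradients there are dual variables, at a cost that vanishes with the increase.
    The support multipliers can be zero, since the primal problem on the right has
    no support constraint. *)
Lemma dual_value_le_primal_value :
  (dual_value nrm p eps G w c H h <= primal_value nrm p eps G w c setT)%E.
Proof.
have E0 : 0 < eps ^+ p by rewrite exprn_gt0.
case PV: (primal_value nrm p eps G w c setT) => [V| |]; last 2 first.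
- by rewrite leey.
- pose jj (_ : 'I_M) := Ordinal J_gt0.
  have [a0 aw] := allocation_pure jj.
  have : primal_feasible nrm p eps w c setT (pure jj) (fun _ k => c k).
    split=> //; rewrite [leLHS](weighted_sum_pure jj (cost (fun _ k => c k))).
    rewrite big1 ?ltW // => k _.
    by rewrite /cost subrr is_norm0 // expr0n (gtn_eqF p_gt0) mulr0.
  by move=> /primal_value_ge; rewrite PV leeNy_eq.
have [|lam0 lam0_ge0 key] := @primal_multiplier V.
  by move=> alpha v /primal_value_ge; rewrite PV lee_fin.
apply/lee_addgt0Pr => e e0; rewrite -EFinD.
(* This increase of the multiplier costs exactly [e] in the dual objective. *)
pose lam := lam0 + e / eps ^+ p.
have lam0_lt : lam0 < lam by rewrite ltrDl divr_gt0.
(* Letting only the point of center [k] vary, and keeping the others at their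
   centers, turns the bound on the sum into one for the single pair [(j, k)]. *)
have bounded j k : exists B, forall v, f j v - lam0 * nrm (v - c k) ^+ p <= B.
  exists ((V - lam0 * eps ^+ p - \sum_(i < M | i != k) w i * f j (c i)) / w k) => v.
  rewrite ler_pdivlMr // mulrC lerBrDr.
  apply: le_trans (key (fun=> j) (fun i => if i == k then v else c i)).
  rewrite [leRHS](bigD1 k) //= eqxx lerD2l; apply: ler_sum => i /negbTE ->.
  by rewrite subrr is_norm0 // expr0n (gtn_eqF p_gt0) mulr0 subr0.
have /choice[u umax] : forall jk : 'I_J * 'I_M, exists u, forall v,
    f jk.1 v - lam * nrm (v - c jk.2) ^+ p <= f jk.1 u - lam * nrm (u - c jk.2) ^+ p.
  move=> [j k]; have [B fB] := bounded j k.
  apply: (penalised_max nrmP _ p_gt0 lam0_lt fB) => v.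
  exact: differentiable_continuous.
pose val j k := f j (u (j, k)) - lam * nrm (u (j, k) - c k) ^+ p.
have /choice[jj jjmax] : forall k, exists j, forall i, val i k <= val j k.
  by move=> k; exact: (exists_argmax (Ordinal J_gt0)).
pose s k := val (jj k) k + lam * eps ^+ p.
apply: le_trans (_ : (dual_objective w s)%:E <= _)%E.
  apply: ereal_inf_lbound.
  exists lam, (fun j k => - gradient (f j) (u (j, k))), (fun _ _ => 0), s.
  split => //; apply: dual_feasible_of_maximisers.
  - exact: le_lt_trans lam0_lt.
  - by move=> j k v; exact: (umax (j, k)).
  - by move=> j k; rewrite lerD2r; exact: jjmax.
rewrite lee_fin /dual_objective /s.
under eq_bigr do rewrite mulrDr.
rewrite big_split /= -mulr_suml w_sum mul1r.
have lamE : lam * eps ^+ p = lam0 * eps ^+ p + e.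
  by rewrite mulrDl divfK // gt_eqF.
have := key jj (fun k => u (jj k, k)).
suff : \sum_(k < M) w k * val (jj k) k <= \sum_(k < M) w k *
    (f (jj k) (u (jj k, k)) - lam0 * nrm (u (jj k, k) - c k) ^+ p) by lra.
apply: ler_sum => k _; rewrite ler_pM2l // lerD2l lerN2.
by rewrite ler_wpM2r ?exprn_ge0 ?is_norm_ge0 // ltW.
Qed.

End Duality.

(** * Passing between clusters and data points *)

Section Clustering.
Context {R : realType} {m J N K : nat}.
Variables (nrm : 'cV[R]_m -> R) (p : nat) (eps : R).
Variables (f : 'I_J -> 'cV[R]_m -> R).
Variables (d : 'I_N -> 'cV[R]_m) (C : 'I_K -> {set 'I_N}).
Hypothesis C_clustering : is_clustering C.

Local Notation G := (fun j u => (f j u)%:E).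
Local Notation wN := (fun _ : 'I_N => N%:R^-1 : R).
Local Notation wK := (cluster_weight C : 'I_K -> R).
Local Notation dbar := (cluster_mean d C).

Lemma exists_cluster_index :
  exists cl : 'I_N -> 'I_K, forall i k, (i \in C k) = (cl i == k).
Proof.
case: C_clustering => _ Cuniq /choice[cl clP].
exists cl => i k; apply/idP/eqP => [iCk|<-]; last exact: clP.
exact: Cuniq (clP i) iCk.
Qed.

Lemma sum_clusters (F : 'I_N -> R) :
  \sum_(i < N) F i = \sum_(k < K) \sum_(i in C k) F i.
Proof.
have [cl clE] := exists_cluster_index.
rewrite (partition_big cl predT) //=; apply: eq_bigr => k _.
by apply: eq_bigl => i; rewrite clE.
Qed.

Lemma card_cluster_gt0 k : 0 < #|C k|%:R :> R.
Proof. by rewrite ltr0n; case: C_clustering. Qed.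

Lemma sum_cluster_deviations k : \sum_(i in C k) (d i - dbar k) = 0.
Proof.
rewrite sumrB sumr_const /cluster_mean -scaler_nat scalerA.
by rewrite mulfV ?gt_eqF ?card_cluster_gt0 // scale1r subrr.
Qed.

Hypothesis N_gt0 : (0 < N)%N.

Lemma cluster_weight_gt0 k : 0 < wK k.
Proof. by rewrite divr_gt0 ?card_cluster_gt0 // ltr0n. Qed.

Lemma sum_cluster_weight : \sum_(k < K) wK k = 1.
Proof.
rewrite /cluster_weight -mulr_suml.
have -> : \sum_(k < K) #|C k|%:R = \sum_(i < N) 1 :> R.
  by rewrite sum_clusters; apply: eq_bigr => k _; rewrite sumr_const.
by rewrite sumr_const card_ord mulfV // pnatr_eq0 -lt0n.
Qed.

Variables (L : 'I_J -> R) (b : R).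
Hypothesis f_diff : forall j u, differentiable (f j) u.
Hypothesis f_smooth : forall j u v,
  l2norm (gradient (f j) v - gradient (f j) u) <= L j * l2norm (u - v).
Hypothesis L_le : forall j, L j / 2 <= b.

(** The first-order terms cancel because the deviations from the cluster mean sum
    to zero. *)
Lemma cluster_shift_lower_bound j k u :
  #|C k|%:R * f j u - b * \sum_(i in C k) l2norm (d i - dbar k) ^+ 2
  <= \sum_(i in C k) f j (u + (d i - dbar k)).
Proof.
apply: (@le_trans _ _ (\sum_(i in C k) (f j u
    + dotv (gradient (f j) u) (d i - dbar k) - b * l2norm (d i - dbar k) ^+ 2))).
  rewrite sumrB big_split /= sumr_const -dotv_sumr sum_cluster_deviations.
  by rewrite dotv0r addr0 mulr_sumr mulr_natl.
apply: ler_sum => i _.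
apply: le_trans (smooth_lower_bound (f_diff j) (f_smooth j) u (d i - dbar k)).
by rewrite lerD2l lerN2 ler_wpM2r // sqr_ge0.
Qed.

(** Each point of an allocation around a cluster mean is translated to every data
    point of the cluster, its mass being shared equally: transport costs are
    unchanged, and only the support constraint may be violated. *)
Lemma clustered_primal_value_le S :
  (primal_value nrm p eps G wK dbar S
   <= primal_value nrm p eps G wN d setT + (b * dispersion d C)%:E)%E.
Proof.
have [cl clE] := exists_cluster_index.
apply: primal_value_le => alpha v [budget _ a0 aw].
pose beta j i := alpha j (cl i) / #|C (cl i)|%:R.
pose u j i := v j (cl i) + (d i - dbar (cl i)).
have spread (F : 'I_J -> 'I_N -> R) : weighted_sum beta F =
    \sum_(k < K) \sum_(j < J) alpha j k / #|C k|%:R * \sum_(i in C k) F j i.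
  rewrite /weighted_sum sum_clusters; apply: eq_bigr => k _.
  rewrite exchange_big /=; apply: eq_bigr => j _; rewrite mulr_sumr.
  by apply: eq_bigr => i; rewrite clE /beta => /eqP ->.
have budget' : weighted_sum beta (fun j i => nrm (u j i - d i) ^+ p) =
    \sum_(k < K) \sum_(j < J) alpha j k * nrm (v j k - dbar k) ^+ p.
  rewrite spread; apply: eq_bigr => k _; apply: eq_bigr => j _.
  rewrite (eq_bigr (fun=> nrm (v j k - dbar k) ^+ p)) => [|i].
    rewrite sumr_const -[X in _ * X]mulr_natl mulrA divfK // gt_eqF //.
    exact: card_cluster_gt0.
  rewrite clE /u => /eqP ->; congr (nrm _ ^+ p).
  by rewrite -addrA [d i - _ - _]addrAC subrr add0r.
have feas : primal_feasible nrm p eps wN d setT beta u.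
  split=> // [|j i|i]; first by rewrite -budget' in budget.
    by rewrite divr_ge0.
  rewrite -mulr_suml aw /cluster_weight mulrAC mulfV ?mul1r //.
  by rewrite gt_eqF // card_cluster_gt0.
apply: le_trans (leeD (primal_value_ge f feas) (lexx _)).
rewrite -EFinD lee_fin spread /dispersion !mulr_sumr -big_split.
apply: ler_sum => k _ /=.
have wE : N%:R^-1 = \sum_(j < J) alpha j k / #|C k|%:R.
  rewrite -mulr_suml aw /cluster_weight mulrAC mulfV ?mul1r //.
  by rewrite gt_eqF // card_cluster_gt0.
rewrite mulrCA wE mulr_suml -big_split; apply: ler_sum => j _ /=.
rewrite -mulrDr mulrAC ler_pdivlMr ?card_cluster_gt0 // -mulrA.
apply: ler_wpM2l => //; rewrite -lerBlDr mulrC.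
apply: le_trans (cluster_shift_lower_bound j k (v j k)) _.
by apply: ler_sum => i; rewrite clE /u => /eqP ->.
Qed.

Context {r : nat}.
Variables (H : 'M[R]_(r, m)) (h : 'cV[R]_r).

(** Giving every data point the dual variables of its cluster changes the
    constraints only by terms linear in its deviation from the cluster mean, and
    raising the level variable by the largest of these restores feasibility. *)
Lemma declustered_dual_value_le lam z gamma s : (0 < J)%N ->
  dual_feasible nrm p eps G dbar H h lam z gamma s ->
  (dual_value nrm p eps G wN d H h
   <= (dual_objective wK s)%:E + delta d C H z gamma)%E
  /\ delta d C H z gamma \is a fin_num.
Proof.
move=> J0 [lam0 gam0 zs].
have [cl clE] := exists_cluster_index.
pose lin j k i := dotv (- z j k - H^T *m gamma j k) (d i - dbar k).
have /choice[jj jjmax] : forall ki : 'I_K * 'I_N, exists j, forall j',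
    lin j' ki.1 ki.2 <= lin j ki.1 ki.2.
  by move=> ki; exact: (exists_argmax (Ordinal J0)).
pose top k i := lin (jj (k, i)) k i.
have deltaE : delta d C H z gamma =
    (N%:R^-1 * \sum_(k < K) \sum_(i in C k) top k i)%:E.
  rewrite /delta EFinM -sumEFin; congr (_ * _)%E; apply: eq_bigr => k _.
  rewrite -sumEFin; apply: eq_bigr => i _.
  exact: (bigmaxe_argmax (F := fun j => lin j k i) (jjmax (k, i))).
split; last by rewrite deltaE.
pose s' i := s (cl i) + top (cl i) i.
have -> : ((dual_objective wK s)%:E + delta d C H z gamma)%E
    = (dual_objective wN s')%:E.
  rewrite deltaE -EFinD; congr EFin; rewrite /dual_objective -mulr_sumr sum_clusters.
  have -> : \sum_(k < K) wK k * s k = N%:R^-1 * \sum_(k < K) #|C k|%:R * s k.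
    by rewrite mulr_sumr; apply: eq_bigr => k _; rewrite mulrA [N%:R^-1 * _]mulrC.
  rewrite -mulrDr -big_split; congr (_ * _); apply: eq_bigr => k _ /=.
  rewrite mulr_natl -sumr_const -big_split; apply: eq_bigr => i /=.
  by rewrite clE /s' => /eqP ->.
apply: ereal_inf_lbound.
exists lam, (fun j i => z j (cl i)), (fun j i => gamma j (cl i)), s'.
split => //; split => // i j; rewrite /s' [leRHS]EFinD.
apply: (le_trans _ (leeD (zs (cl i) j) (_ : (lin j (cl i) i)%:E <= _)%E)); last first.
  by rewrite lee_fin; exact: (jjmax (cl i, i)).
set k := cl i; rewrite [leRHS]addeAC -[X in (_ <= X + _)%E]addeA -EFinD.
rewrite le_eqVlt; apply/orP; left; apply/eqP; congr (_ + _%:E + _)%E.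
have adj (y : 'cV[R]_m) : dotv (H^T *m gamma j k) y = dotv (gamma j k) (H *m y).
  rewrite /dotv; under eq_bigr do rewrite mxE mulr_suml.
  rewrite exchange_big /=; apply: eq_bigr => l _; rewrite mxE mulr_sumr.
  by apply: eq_bigr => q _; rewrite mxE mulrA [_ * gamma _ _ _ _]mulrC.
rewrite /lin dotvBl dotvNl adj mulmxBr !dotvBr; ring.
Qed.

End Clustering.

(** * Clustering bounds *)

Lemma convex_fun_fine {R : realType} {m : nat} (f : 'cV[R]_m -> R) :
  ext_convex (fun u => - (f u)%:E)%E -> convex_fun (fun u => - f u).
Proof. by move=> cf u v t t01; rewrite -lee_fin; exact: cf. Qed.

Unset Implicit Arguments.

Theorem theorem4p2 (R : realType) (m n r J N K p : nat)
  (X : set 'cV[R]_n) (g : 'I_J -> 'cV[R]_m -> 'cV[R]_n -> \bar R)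
  (nrm : 'cV[R]_m -> R) (eps : R)
  (H : 'M[R]_(r, m)) (h : 'cV[R]_r)
  (d : 'I_N -> 'cV[R]_m) (C : 'I_K -> {set 'I_N})
  (x : 'cV[R]_n) (L : 'I_J -> R) :
  compact X ->
  (forall j x', X x' ->
     [/\ ext_proper (fun u => - g j u x')%E,
         ext_convex (fun u => - g j u x')%E
       & lower_semicontinuous (fun u => - g j u x')%E]) ->
  is_norm nrm -> 0 < eps -> (1 <= p)%N ->
  (0 < N)%N ->
  (forall i, polyhedron H h (d i)) ->
  is_clustering C ->
  X x ->
  concave_dom (fun u => \big[maxe/-oo%E]_(j < J) g j u x) = [set: 'cV[R]_m] ->
  (forall j, smooth (L j) (fun u => g j u x)) ->
  let G := fun j u => g j u x in
  let wN := fun _ : 'I_N => N%:R^-1 : R in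
  let wK := cluster_weight C : 'I_K -> R in
  let dbar := cluster_mean d C in
  let gN_dual := dual_value nrm p eps G wN d H h in
  let gK_dual := dual_value nrm p eps G wK dbar H h in
  let gK := primal_value nrm p eps G wK dbar (polyhedron H h) in
  let gNstar := primal_value nrm p eps G wN d [set: 'cV[R]_m] in
  let bound :=
    (gNstar
     + (\big[maxe/-oo]_(j < J) (L j / 2)%:E) * (dispersion d C)%:E)%E in
  [/\ forall (lambda : R) (z : 'I_J -> 'I_K -> 'cV[R]_m)
             (gamma : 'I_J -> 'I_K -> 'cV[R]_r) (s : 'I_K -> R),
        dual_optimal nrm p eps G wK dbar H h lambda z gamma s ->
        (gN_dual - delta d C H z gamma <= gK_dual)%E,
      (gK_dual <= bound)%E
    & (gK <= bound)%E].

Proof.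
move=> _ gP nrmP eps0 p1 N0 _ CP Xx gdom gsmooth.
move=> G wN wK dbar gN_dual gK_dual gK gNstar bound.
pose f j u := fine (g j u x).
have gE j u : g j u x = (f j u)%:E.
  by rewrite /f fineK //; case: (gsmooth j).
have GE : G = fun j u => (f j u)%:E by do 2 apply: funext => ?; exact: gE.
have f_diff j u : differentiable (f j) u by case: (gsmooth j).
have f_smooth j : forall u v,
    l2norm (gradient (f j) v - gradient (f j) u) <= L j * l2norm (u - v).
  by case: (gsmooth j).
have f_concave j : convex_fun (fun u => - f j u).
  have [_ cf _] := gP j x Xx; apply: convex_fun_fine.
  rewrite (_ : (fun u => _) = (fun u => - g j u x)%E) //.
  by apply: funext => u; rewrite gE.
(* Over an empty index set the maximum is [-oo] everywhere. *)
have J0 : (0 < J)%N.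
  case: (posnP J) => // J00; have : [set: 'cV[R]_m] 0 by [].
  by rewrite -gdom /concave_dom /= big_pred0 // => -[i]; rewrite J00.
have [jL LjL] := exists_argmax (Ordinal J0) (fun j => L j / 2).
have boundE : bound = (gNstar + (L jL / 2 * dispersion d C)%:E)%E.
  by rewrite /bound (bigmaxe_argmax LjL) -EFinM.
have gK_le S : (primal_value nrm p eps G wK dbar S <= bound)%E.
  rewrite boundE /gNstar GE.
  exact: (clustered_primal_value_le nrm p eps d CP f_diff f_smooth LjL).
split; last exact: gK_le.
- move=> lam z gamma s [feas opt].
  have gK_dualE : gK_dual = (dual_objective wK s)%:E.
    apply/eqP; rewrite eq_le; apply/andP; split.
      by apply: ereal_inf_lbound; exists lam, z, gamma, s.
    apply: le_ereal_inf_tmp => _ [lam' [z' [gamma' [s' [feas' ->]]]]].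
    by rewrite lee_fin; exact: opt feas'.
  rewrite GE in feas; have [le fin] := declustered_dual_value_le CP J0 feas.
  by rewrite leeBlDr // gK_dualE /gN_dual GE.
- apply: le_trans (gK_le setT); rewrite /gK_dual GE.
  apply: dual_value_le_primal_value => //.
  + exact: cluster_weight_gt0.
  + exact: sum_cluster_weight.
Qed.
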